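(* Let $m\ge 2$ be an integer, let $G$ be an $(m-1)$-torsion free group, let $A$ and $B$ be two commutative $G$-graded rings, let $f:A\to B$ be a graded ring homomorphism, and let $J$ be a homogeneous ideal of $B$. Then the following conditions are equivalent: (i) $A\bowtie^f J$ is a graded $m$-nil clean ring; (ii) $A$ and $f(A)+J$ are graded $m$-nil clean rings.
   Context: Rings have an identity. A ring $R$ is $G$-graded ($G$ a group with identity $e$) if $R=\bigoplus_{g\in G}R_g$ with additive subgroups satisfying $R_gR_h\subseteq R_{gh}$; elements of $\bigcup_g R_g$ are homogeneous. A graded ring homomorphism $f:A\to B$ is a ring homomorphism with $f(A_g)\subseteq B_g$ for all $g\in G$. An ideal $J$ of $B$ is homogeneous if $J=\bigoplus_g J_g$ with $J_g=J\cap B_g$. The amalgamation of $A$ with $B$ along $J$ with respect to $f$ is the subring $A\bowtie^f J=\{(a,f(a)+j): a\in A,\ j\in J\}$ of $A\times B$, graded by $(A\bowtie^f J)_g=\{(a_g,f(a_g)+j_g): a_g\in A_g,\ j_g\in J_g\}$. The subring $f(A)+J$ of $B$ is graded by $(f(A)+J)_g=f(A_g)+J_g$. An element $x$ is $m$-potent if $x^m=x$. A $G$-graded ring is graded $m$-nil clean if every homogeneous element is the sum of a homogeneous $m$-potent and a homogeneous nilpotent. A group $G$ is $k$-torsion free if $g^k=e$ implies $g=e$ for every $g\in G$. *)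

(* Defs.v *)
From HB Require Import structures.
From mathcomp Require Import all_boot all_order all_algebra.
From mathcomp Require Import finmap boolp classical_sets functions.

Set Implicit Arguments.
Unset Strict Implicit.
Unset Printing Implicit Defensive.

Import GRing.Theory.
Local Open Scope ring_scope.
Local Open Scope classical_set_scope.

Definition torsion_free (k : nat) (G : groupType) : Prop :=
  forall g : G, (g ^+ k = 1)%g -> g = 1%g.

(* S is the internal direct sum of the C g: every element of S is the sum of
   exactly one finitely supported family picked in the C g, and all these sums
   lie in S. *)
Definition is_direct_sum (I : choiceType) (V : zmodType) (S : set V)
    (C : I -> set V) : Prop :=
  set_bij [set d : {fsfun I -> V with 0} | forall i, C i (d i)] S
    (fun d => \sum_(i <- finsupp d) d i).

(* Zero rings (the Pz structures) are allowed. *)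
Record grading (G : groupType) (R : pzRingType) := Grading {
  component :> G -> set R;
  component_zmod : forall g, zmod_closed [in component g];
  component_mul : forall g h x y, component g x -> component h y ->
    component (g * h)%g (x * y);
  component_direct : is_direct_sum setT component }.

Definition homogeneous (G : groupType) (R : pzRingType) (gr : grading G R) :
    set R :=
  \bigcup_g gr g.

Definition graded_morphism (G : groupType) (A B : pzRingType)
    (grA : grading G A) (grB : grading G B) (f : A -> B) : Prop :=
  forall g, f @` grA g `<=` grB g.

Definition nilpotent (R : pzRingType) (x : R) : Prop := exists n, x ^+ n = 0.

Definition potent (m : nat) (R : pzRingType) (x : R) : Prop := x ^+ m = x.

Definition graded_nil_clean (m : nat) (G : groupType) (R : pzRingType)
    (gr : grading G R) : Prop :=
  forall x, homogeneous gr x -> exists p n : R,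
    [/\ homogeneous gr p, potent m p, homogeneous gr n, nilpotent n
      & x = p + n].

(* The library's idealr only covers proper ideals. *)
Record ideal (R : comPzRingType) := Ideal {
  ideal_set :> set R;
  ideal_zmod : zmod_closed [in ideal_set];
  ideal_mul : forall a x, ideal_set x -> ideal_set (a * x) }.

Definition homogeneous_ideal (G : groupType) (R : comPzRingType)
    (gr : grading G R) (J : ideal R) : Prop :=
  is_direct_sum J (fun g => J `&` gr g).

Section DirectSum.
Variables (I : choiceType) (V : zmodType).
Implicit Types (S : set V) (C : I -> set V) (s t : {fset I}) (c : I -> V).

Lemma zmod_set0 (X : set V) : zmod_closed [in X] -> X 0.
Proof. by case=> /set_mem. Qed.

Lemma zmod_setB (X : set V) x y : zmod_closed [in X] -> X x -> X y -> X (x - y).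
Proof.
case=> _ cB Xx Xy; apply/set_mem; apply: cB; exact/mem_set.
Qed.

Lemma zmod_setN (X : set V) x : zmod_closed [in X] -> X x -> X (- x).
Proof.
by move=> zX Xx; rewrite -[- x]add0r; apply: zmod_setB (zmod_set0 zX) Xx.
Qed.

Lemma zmod_setD (X : set V) x y : zmod_closed [in X] -> X x -> X y -> X (x + y).
Proof.
by move=> zX Xx Xy; rewrite -[y]opprK; apply: zmod_setB (zmod_setN zX Xy).
Qed.

Lemma sum_finsupp (W : nmodType) (d : {fsfun I -> W with 0}) s :
  (finsupp d `<=` s)%fset -> \sum_(i <- finsupp d) d i = \sum_(i <- s) d i.
Proof.
move=> sub; apply: big_fset_incl => // i _; exact: fsfun_dflt.
Qed.

Lemma sum_fsfun c s (d := [fsfun i in s => c i | 0] : {fsfun I -> V with 0}) :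
  \sum_(i <- finsupp d) d i = \sum_(i <- s) c i.
Proof.
rewrite (@sum_finsupp _ _ s); last by apply/fsubsetP=> i; apply: contraLR;
  move=> nis; rewrite mem_finsupp fsfunE (negPf nis) eqxx.
by apply: eq_big_seq => i si; rewrite fsfunE si.
Qed.

Lemma direct_sum_decomp S C x : is_direct_sum S C -> S x ->
  exists2 d : {fsfun I -> V with 0},
    forall i, C i (d i) & \sum_(i <- finsupp d) d i = x.
Proof. by case=> _ _ sur /sur. Qed.

Lemma direct_sum_free S C s c : is_direct_sum S C ->
    (forall i, zmod_closed [in C i]) -> (forall i, C i (c i)) ->
  \sum_(i <- s) c i = 0 -> forall i, i \in s -> c i = 0.
Proof.
case=> _ inj _ zC Cc sum0 i si.
pose d := [fsfun i in s => c i | 0] : {fsfun I -> V with 0}.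
have Cd j : C j (d j) by rewrite fsfunE; case: ifP => // _; apply: zmod_set0.
have C0 j : C j ([fsfun with 0] j : V) by rewrite fsfunE; apply: zmod_set0.
have := inj d [fsfun with 0] (mem_set Cd) (mem_set C0).
rewrite sum_fsfun sum0 finsupp0 big_seq_fset0 => /(_ erefl) /fsfunP /(_ i).
by rewrite !fsfunE si.
Qed.

Lemma direct_sumT C : (forall i, zmod_closed [in C i]) ->
    (forall x, exists s, exists2 c, forall i, C i (c i)
       & \sum_(i <- s) c i = x) ->
    (forall s c, (forall i, C i (c i)) -> \sum_(i <- s) c i = 0 ->
       forall i, i \in s -> c i = 0) ->
  is_direct_sum setT C.
Proof.
move=> zC span free; split=> // [d d' /set_mem Cd /set_mem Cd' eq|x _].
  apply/fsfunP => i; apply/eqP; rewrite -subr_eq0; apply/eqP.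
  set s := (finsupp d `|` finsupp d')%fset.
  have /free : forall i, C i (d i - d' i) by move=> j; apply: zmod_setB.
  move=> /(_ s); rewrite sumrB -!sum_finsupp ?fsubsetUl ?fsubsetUr // eq subrr.
  have [si /(_ erefl _ si)//|] := boolP (i \in s).
  by rewrite in_fsetU => /norP[ni ni'] _; rewrite !fsfun_dflt // subrr.
have [s [c Cc <-]] := span x.
exists [fsfun i in s => c i | 0]; last exact: sum_fsfun.
by move=> i; rewrite fsfunE; case: ifP => // _; apply: zmod_set0.
Qed.

End DirectSum.

Section Amalgamation.
Variables (A B : comPzRingType) (f : {rmorphism A -> B}) (J : ideal B).

Definition amalg_pred : {pred A * B} :=
  [in [set (a, f a + j) | a in [set: A] & j in (J : set B)]].

Definition sumring_pred : {pred B} :=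
  [in [set f a + j | a in [set: A] & j in (J : set B)]].

Lemma amalg_subring : subring_closed amalg_pred.
Proof.
split.
- apply/mem_set; exists 1 => //; exists 0; first exact: zmod_set0 (ideal_zmod J).
  by rewrite rmorph1 addr0.
- move=> _ _ /set_mem[a _ [j Jj <-]] /set_mem[b _ [k Jk <-]].
  apply/mem_set; exists (a - b) => //; exists (j - k).
    exact: zmod_setB (ideal_zmod J) Jj Jk.
  by congr (_, _); rewrite rmorphB /= opprD addrACA.
- move=> _ _ /set_mem[a _ [j Jj <-]] /set_mem[b _ [k Jk <-]].
  apply/mem_set; exists (a * b) => //.
  exists ((f a + j) * k + f b * j).
    by apply: zmod_setD (ideal_zmod J) _ _; apply: ideal_mul.
  congr (_, _); rewrite rmorphM /= mulrDr [(f a + j) * f b]mulrDl.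
  by rewrite (mulrC j) -addrA [_ * k + _]addrC.
Qed.

Lemma sumring_subring : subring_closed sumring_pred.
Proof.
split.
- apply/mem_set; exists 1 => //; exists 0; first exact: zmod_set0 (ideal_zmod J).
  by rewrite rmorph1 addr0.
- move=> _ _ /set_mem[a _ [j Jj <-]] /set_mem[b _ [k Jk <-]].
  apply/mem_set; exists (a - b) => //; exists (j - k).
    exact: zmod_setB (ideal_zmod J) Jj Jk.
  by rewrite rmorphB /= opprD addrACA.
- move=> _ _ /set_mem[a _ [j Jj <-]] /set_mem[b _ [k Jk <-]].
  apply/mem_set; exists (a * b) => //.
  exists ((f a + j) * k + f b * j).
    by apply: zmod_setD (ideal_zmod J) _ _; apply: ideal_mul.
  rewrite rmorphM /= mulrDr [(f a + j) * f b]mulrDl.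
  by rewrite (mulrC j) -addrA [_ * k + _]addrC.
Qed.

Record amalg := Amalg { amalg_val : A * B; _ : amalg_val \in amalg_pred }.
HB.instance Definition _ := [isSub for amalg_val].
HB.instance Definition _ := [Choice of amalg by <:].
HB.instance Definition _ := GRing.SubChoice_isSubComPzRing.Build
  (A * B)%type amalg_pred amalg amalg_subring.

Record sumring := Sumring { sumring_val : B; _ : sumring_val \in sumring_pred }.
HB.instance Definition _ := [isSub for sumring_val].
HB.instance Definition _ := [Choice of sumring by <:].
HB.instance Definition _ := GRing.SubChoice_isSubComPzRing.Build
  B sumring_pred sumring sumring_subring.

Lemma amalg_val0 : amalg_val 0 = 0. Proof. exact: (raddf0 val). Qed.

Lemma amalg_valB : {morph @amalg_val : x y / x - y}.
Proof. exact: (raddfB val). Qed.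

Lemma amalg_valM : {morph @amalg_val : x y / x * y}.
Proof. exact: (rmorphM val). Qed.

Lemma amalg_val_sum (I : Type) (r : seq I) (F : I -> amalg) :
  amalg_val (\sum_(i <- r) F i) = \sum_(i <- r) amalg_val (F i).
Proof. exact: (raddf_sum val). Qed.

Lemma sumring_val0 : sumring_val 0 = 0. Proof. exact: (raddf0 val). Qed.

Lemma sumring_valB : {morph @sumring_val : x y / x - y}.
Proof. exact: (raddfB val). Qed.

Lemma sumring_valM : {morph @sumring_val : x y / x * y}.
Proof. exact: (rmorphM val). Qed.

Lemma sumring_val_sum (I : Type) (r : seq I) (F : I -> sumring) :
  sumring_val (\sum_(i <- r) F i) = \sum_(i <- r) sumring_val (F i).
Proof. exact: (raddf_sum val). Qed.

Variables (G : groupType) (grA : grading G A) (grB : grading G B).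

Definition amalg_component (g : G) : set amalg :=
  @amalg_val @^-1` [set (a, f a + j) | a in grA g & j in J `&` grB g].

Definition sumring_component (g : G) : set sumring :=
  @sumring_val @^-1` [set f a + j | a in grA g & j in J `&` grB g].

Hypotheses (fgr : graded_morphism grA grB f) (Jgr : homogeneous_ideal grB J).

Let fg g a : grA g a -> grB g (f a).
Proof. by move=> Aa; apply: fgr; exists a. Qed.

Let Jmulr x y : ideal_set J x -> ideal_set J (x * y).
Proof. by rewrite mulrC; apply: ideal_mul. Qed.

Let Jg_zmod g : zmod_closed [in J `&` grB g].
Proof.
split=> [|x y /set_mem[Jx Bx] /set_mem[Jy By]]; apply/mem_set; split.
- exact: zmod_set0 (ideal_zmod J).
- exact: zmod_set0 (component_zmod grB g).
- exact: zmod_setB (ideal_zmod J) Jx Jy.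
- exact: zmod_setB (component_zmod grB g) Bx By.
Qed.

Lemma amalg_component_zmod g : zmod_closed [in amalg_component g].
Proof.
split=> [|x y /set_mem[a Aa [j Jj xE]] /set_mem[b Ab [k Jk yE]]]; apply/mem_set.
  exists 0; first exact: zmod_set0 (component_zmod grA g).
  exists 0; first exact: zmod_set0 (Jg_zmod g).
  by rewrite rmorph0 addr0 amalg_val0.
exists (a - b); first exact: zmod_setB (component_zmod grA g) Aa Ab.
exists (j - k); first exact: zmod_setB (Jg_zmod g) Jj Jk.
by rewrite amalg_valB -xE -yE; congr (_, _); rewrite rmorphB /= opprD addrACA.
Qed.

Lemma sumring_component_zmod g : zmod_closed [in sumring_component g].
Proof.
split=> [|x y /set_mem[a Aa [j Jj xE]] /set_mem[b Ab [k Jk yE]]]; apply/mem_set.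
  exists 0; first exact: zmod_set0 (component_zmod grA g).
  exists 0; first exact: zmod_set0 (Jg_zmod g).
  by rewrite rmorph0 addr0 sumring_val0.
exists (a - b); first exact: zmod_setB (component_zmod grA g) Aa Ab.
exists (j - k); first exact: zmod_setB (Jg_zmod g) Jj Jk.
by rewrite sumring_valB -xE -yE rmorphB /= opprD addrACA.
Qed.

Let cross_term g h a b j k :
    grA g a -> grA h b -> (J `&` grB g) j -> (J `&` grB h) k ->
  (J `&` grB (g * h)%g) (f a * k + j * f b + j * k).
Proof.
move=> Aa Ab [Jj Bj] [Jk Bk]; split.
  apply: zmod_setD (ideal_zmod J) _ _; last exact: ideal_mul.
  by apply: zmod_setD (ideal_zmod J) _ _; [apply: ideal_mul|apply: Jmulr].
apply: zmod_setD (component_zmod grB _) _ _.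
  by apply: zmod_setD (component_zmod grB _) _ _; apply: component_mul => //;
    apply: fg.
exact: component_mul.
Qed.

Let cross_eq a b j k :
  (f a + j) * (f b + k) = f (a * b) + (f a * k + j * f b + j * k).
Proof. by rewrite rmorphM mulrDl !mulrDr !addrA. Qed.

Lemma amalg_component_mul g h x y :
  amalg_component g x -> amalg_component h y -> amalg_component (g * h)%g (x * y).
Proof.
case=> a Aa [j Jj xE] [b Ab [k Jk yE]].
exists (a * b); first exact: component_mul.
exists (f a * k + j * f b + j * k); first exact: cross_term.
by rewrite amalg_valM -xE -yE; congr (_, _); rewrite -cross_eq.
Qed.

Lemma sumring_component_mul g h x y :
  sumring_component g x -> sumring_component h y ->
  sumring_component (g * h)%g (x * y).
Proof.
case=> a Aa [j Jj xE] [b Ab [k Jk yE]].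
exists (a * b); first exact: component_mul.
exists (f a * k + j * f b + j * k); first exact: cross_term.
by rewrite sumring_valM -xE -yE -cross_eq.
Qed.

Let fst_amalg g x : amalg_component g x -> grA g (amalg_val x).1.
Proof. by case=> a Aa [j Jj <-]. Qed.

Let snd_amalg g x : amalg_component g x -> grB g (amalg_val x).2.
Proof.
by case=> a Aa [j [_ Bj] <-]; apply: zmod_setD (component_zmod grB g) (fg Aa) Bj.
Qed.

Let val_sumring g x : sumring_component g x -> grB g (sumring_val x).
Proof.
by case=> a Aa [j [_ Bj] <-]; apply: zmod_setD (component_zmod grB g) (fg Aa) Bj.
Qed.

Let decomp a j : ideal_set J j -> exists s : {fset G}, exists2 c : G -> A * B,
  forall g, grA g (c g).1 /\ (J `&` grB g) (c g).2
  & \sum_(g <- s) (c g).1 = a /\ \sum_(g <- s) (c g).2 = j.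
Proof.
move=> Jj; have [d Ad <-] := direct_sum_decomp (component_direct grA) (I : setT a).
have [e Je <-] := direct_sum_decomp Jgr Jj.
exists (finsupp d `|` finsupp e)%fset, (fun g => (d g, e g)) => /=.
  by move=> g; split; [apply: Ad|apply: Je].
by split; apply/esym/sum_finsupp; rewrite ?fsubsetUl ?fsubsetUr.
Qed.

Lemma amalg_direct : is_direct_sum setT amalg_component.
Proof.
apply: direct_sumT amalg_component_zmod _ _ => [x|s c Cc sum0 g gs].
  have /set_mem[a _ [j Jj xE]] := valP x.
  have [s [c Cc [aE jE]]] := decomp a Jj.
  have mem g : ((c g).1, f (c g).1 + (c g).2) \in amalg_pred.
    apply/mem_set; exists (c g).1 => //; exists (c g).2 => //.
    by case: (Cc g) => _ [].
  exists s, (fun g => Amalg (mem g)).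
    by move=> g; have [Ag Jg] := Cc g; exists (c g).1 => //; exists (c g).2.
  apply: val_inj => /=; rewrite -[RHS]xE amalg_val_sum /= -aE -jE rmorph_sum /=.
  rewrite -big_split /=.
  by rewrite [LHS]surjective_pairing !raddf_sum.
have /(congr1 amalg_val) := sum0; rewrite amalg_val_sum amalg_val0 /= => sum0'.
apply: val_inj => /=; rewrite [LHS]surjective_pairing; congr (_, _).
  apply: (direct_sum_free (component_direct grA) (component_zmod grA)
    (c := fun g => (amalg_val (c g)).1) _ _ gs) => [h|]; first exact: fst_amalg.
  by have /(congr1 fst) := sum0'; rewrite raddf_sum.
apply: (direct_sum_free (component_direct grB) (component_zmod grB)
  (c := fun g => (amalg_val (c g)).2) _ _ gs) => [h|]; first exact: snd_amalg.
by have /(congr1 snd) := sum0'; rewrite raddf_sum.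
Qed.

Lemma sumring_direct : is_direct_sum setT sumring_component.
Proof.
apply: direct_sumT sumring_component_zmod _ _ => [x|s c Cc sum0 g gs].
  have /set_mem[a _ [j Jj xE]] := valP x.
  have [s [c Cc [aE jE]]] := decomp a Jj.
  have mem g : f (c g).1 + (c g).2 \in sumring_pred.
    apply/mem_set; exists (c g).1 => //; exists (c g).2 => //.
    by case: (Cc g) => _ [].
  exists s, (fun g => Sumring (mem g)).
    by move=> g; have [Ag Jg] := Cc g; exists (c g).1 => //; exists (c g).2.
  apply: val_inj => /=; rewrite -[RHS]xE sumring_val_sum /= -aE -jE rmorph_sum.
  by rewrite /= -big_split.
apply: val_inj => /=; apply: (direct_sum_free (component_direct grB)
  (component_zmod grB) (c := fun g => sumring_val (c g)) _ _ gs) => [h|].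
  exact: val_sumring.
by have /(congr1 sumring_val) := sum0; rewrite sumring_val_sum sumring_val0.
Qed.

Definition amalg_grading : grading G amalg :=
  Grading amalg_component_zmod amalg_component_mul amalg_direct.

Definition sumring_grading : grading G sumring :=
  Grading sumring_component_zmod sumring_component_mul sumring_direct.

End Amalgamation.

(* Main.v *)
Require Import Defs.
From HB Require Import structures.
From mathcomp Require Import all_boot all_order all_algebra cyclic ring.
From mathcomp Require Import finmap boolp classical_sets functions.

(** The ring of the amalgamation embeds in the product of A and f(A) + J, and
both factors are images of it, degree by degree.  Images of graded m-nil clean
rings are graded m-nil clean, so one implication is immediate
([nil_clean_image]).  For the other, a decomposition in each factor does not
give one in the subring, because the two potent parts need not fit together.
What does pass to a subring of a product is nilpotency; the idea is therefore
to express graded m-nil cleanness by nilpotency conditions alone.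

In a graded m-nil clean ring,
- a homogeneous x of degree g <> 1 is nilpotent: a nonzero homogeneous potent
  element has degree h with h ^ m = h, hence h = 1 by torsion freeness
  ([nil_clean_degree_neq1]);
- for x homogeneous, x ^ m - x is nilpotent, since this is so for x = p + n with
  p potent and n nilpotent; applied to 2x, it shows that (2 ^ m - 2) x is
  nilpotent too ([nil_clean_torsion]).

Conversely, if x ^ m - x and k x are nilpotent for some k > 0, then x is the
sum of an m-potent and a nilpotent element, and the potent part is a polynomial
in x with integer coefficients and no constant term, hence lies in the
component of degree 1 when x does ([potent_lift]).  The torsion condition is
essential, as potent elements do not lift along nilpotent ideals in general
(X is a square root of 1 modulo the nilradical of Z[X] / (X ^ 2 - 1) ^ 2, but
no square root of 1 is congruent to it).  A Bezout relation splits x into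
parts whose product is nilpotent, each torsion for a prime q modulo nilpotents.
For such an x, the powers x ^ (q ^ i) are periodic modulo nilpotents and the
Frobenius is injective there, so that x ^ Q - x is nilpotent for some Q = q ^ T
with T > 0.  Raising to the power Q repeatedly does not change x modulo
nilpotents but turns congruences into equalities: x ^ m and x have equal powers
of exponent Q ^ t for large t, so that x ^ (Q ^ t) is m-potent. *)

Set Implicit Arguments.
Unset Strict Implicit.
Unset Printing Implicit Defensive.

Import GRing.Theory.
Local Open Scope ring_scope.
Local Open Scope classical_set_scope.

(** * Congruences modulo nilpotent elements *)

Section Nilpotent.
Variable R : comPzRingType.
Implicit Types a b c d x y : R.

Lemma nilpotent0 : nilpotent (0 : R).
Proof. by exists 1%N; rewrite expr1. Qed.

Lemma nilpotentMr x y : nilpotent x -> nilpotent (x * y).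
Proof. by case=> n xn; exists n; rewrite exprMn xn mul0r. Qed.

Lemma nilpotentMl x y : nilpotent y -> nilpotent (x * y).
Proof. by rewrite mulrC; apply: nilpotentMr. Qed.

Lemma nilpotentX x n : nilpotent (x ^+ n) -> nilpotent x.
Proof. by case=> k xk; exists (n * k)%N; rewrite exprM. Qed.

Lemma nilpotentN x : nilpotent x -> nilpotent (- x).
Proof. by rewrite -mulN1r; apply: nilpotentMl. Qed.

Lemma nilpotentMn x n : nilpotent x -> nilpotent (x *+ n).
Proof. by rewrite -mulr_natr; apply: nilpotentMr. Qed.

Lemma nilpotentD x y : nilpotent x -> nilpotent y -> nilpotent (x + y).
Proof.
move=> [n xn] [k yk]; exists (n + k)%N; rewrite exprDn big1 // => i _.
have [ki|ik] := leqP k i.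
  by rewrite -(subnKC ki) [y ^+ _]exprD yk mul0r mulr0 mul0rn.
have ni : (n <= n + k - i)%N by rewrite -addnBA ?leq_addr // ltnW.
by rewrite -(subnKC ni) exprD xn !mul0r mul0rn.
Qed.

Lemma nilpotentB x y : nilpotent x -> nilpotent y -> nilpotent (x - y).
Proof. by move=> nx ny; apply: nilpotentD (nilpotentN ny). Qed.

Lemma nilpotent_sum (I : Type) (r : seq I) (P : pred I) (F : I -> R) :
  (forall i, P i -> nilpotent (F i)) -> nilpotent (\sum_(i <- r | P i) F i).
Proof. exact: (big_ind (@nilpotent R) nilpotent0 nilpotentD). Qed.

Lemma nilpotent_sym x y : nilpotent (x - y) -> nilpotent (y - x).
Proof. by move/nilpotentN; rewrite opprB. Qed.

Lemma nilpotent_trans y x z :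
  nilpotent (x - y) -> nilpotent (y - z) -> nilpotent (x - z).
Proof. by move=> xy yz; rewrite -(subrKA y); apply: nilpotentD. Qed.

Lemma nilpotent_subX x y n : nilpotent (x - y) -> nilpotent (x ^+ n - y ^+ n).
Proof. by rewrite subrXX; apply: nilpotentMr. Qed.

Lemma exprD_disjoint a b n :
  exists c, (a + b) ^+ n.+1 = a ^+ n.+1 + b ^+ n.+1 + a * b * c.
Proof.
elim: n => [|n [c E]]; first by exists 0; rewrite !expr1 mulr0 addr0.
exists (a ^+ n + b ^+ n + a * c + b * c); rewrite exprS E !exprS; ring.
Qed.

Lemma exprD_first_order b d n :
  exists c, (b + d) ^+ n.+1 = b ^+ n.+1 + d * (b ^+ n *+ n.+1 + d * c).
Proof.
elim: n => [|n [c E]].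
  by exists 0; rewrite !expr1 expr0 mulr1n mulr0 addr0 mulr1.
exists (b * c + b ^+ n *+ n.+1 + d * c); rewrite exprS E !exprS; ring.
Qed.

(** Each q-th power multiplies the difference d of the two sides by an element
of the ideal generated by a - b and q b, since
(b + d) ^ q - b ^ q = d (q b ^ (q - 1) + d c) and d stays a multiple of a - b.
This ideal is nilpotent, so the difference vanishes in the end. *)
Lemma iter_power_eq q a b : (1 < q)%N -> nilpotent (a - b) ->
  nilpotent (b *+ q) -> exists t, a ^+ (q ^ t) = b ^+ (q ^ t).
Proof.
move=> q1 [s1 us] [s2 vs]; set u := a - b in us *; set v := b *+ q in vs *.
pose N := (s1 + s2)%N.
have big i j : (N <= i + j)%N -> u ^+ i * v ^+ j = 0.
  move=> Nij; have [si|si] := leqP s1 i.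
    by rewrite -(subnKC si) exprD us !mul0r.
  have sj : (s2 <= j)%N.
    by rewrite -(leq_add2l s1) (leq_trans Nij) // leq_add2r ltnW.
  by rewrite -(subnKC sj) [v ^+ _]exprD vs mul0r mulr0.
(* A product of t elements of the ideal (u, v) is annihilated by the monomials
   of degree at least N - t; this form avoids expanding such products. *)
pose d t := a ^+ (q ^ t) - b ^+ (q ^ t).
have step t : (exists w, d t = u * w) /\
    forall i j, (N <= i + j + t)%N -> d t * (u ^+ i * v ^+ j) = 0.
  elim: t => [|t [[w dE] IH]].
    split=> [|i j]; first by exists 1; rewrite /d !expr1 mulr1.
    by rewrite addn0 => Nij; rewrite big ?mulr0.
  have [r rE] : exists r, b ^+ (q ^ t) ^+ q.-1 *+ q = v * r.
    have e0 : (0 < q ^ t * q.-1)%N.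
      by rewrite muln_gt0 expn_gt0 (ltnW q1) -ltnS prednK // ltnW.
    exists (b ^+ (q ^ t * q.-1).-1).
    by rewrite -exprM -[in LHS](prednK e0) exprS mulrnAl.
  have [c] := exprD_first_order (b ^+ (q ^ t)) (d t) q.-1.
  rewrite prednK ?(ltnW q1) // addrC subrK rE -!exprM => E.
  have {}E : d t.+1 = d t * (v * r + d t * c).
    by rewrite /d expnSr E addrC addKr.
  split=> [|i j Nij]; first by exists (w * (v * r + d t * c)); rewrite E dE mulrA.
  have e1 : d t * (u ^+ i * v ^+ j.+1) = 0 by apply: IH; rewrite addnS addSnnS.
  have e2 : d t * (u ^+ i.+1 * v ^+ j) = 0 by apply: IH; rewrite addSn addSnnS.
  transitivity (d t * (u ^+ i * v ^+ j.+1) * r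
                + d t * (u ^+ i.+1 * v ^+ j) * (w * c)).
    by rewrite E [in v * r + _]dE !exprS; ring.
  by rewrite e1 e2 !mul0r addr0.
exists N; apply/eqP; rewrite -subr_eq0; apply/eqP.
have [_ /(_ 0 0)%N] := step N.
by rewrite !expr0 !mulr1; apply.
Qed.

Lemma nilpotent_frobenius q b d : prime q -> nilpotent (b *+ q) ->
  nilpotent ((b + d) ^+ q - (b ^+ q + d ^+ q)).
Proof.
move=> qp nb; have q0 := prime_gt0 qp.
rewrite exprDn -(prednK q0) big_ord_recr big_ord_recl /= prednK //.
rewrite subn0 expr0 mulr1 bin0 mulr1n subnn expr0 mul1r binn mulr1n.
rewrite opprD addrACA subrr addr0 addrC addrA addNr add0r.
apply: nilpotent_sum => i _; rewrite /bump /= add1n.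
have iq : (i.+1 < q)%N by rewrite -ltn_predRL ltn_ord.
have /dvdnP[c ->] : (q %| 'C(q, i.+1))%N by apply: prime_dvd_bin.
have [e ->] : exists e, (q - i.+1)%N = e.+1.
  by exists (q - i.+1).-1; rewrite prednK // subn_gt0.
have -> : b ^+ e.+1 * d ^+ i.+1 *+ (c * q) = b *+ q * (b ^+ e * d ^+ i.+1 *+ c).
  by rewrite exprS; ring.
exact: nilpotentMr.
Qed.

(** Modulo nilpotents, (a - b) ^ q is a ^ q - b ^ q as soon as q b vanishes:
the Frobenius is then additive, and it is injective in a reduced ring. *)
Lemma frobenius_reflects_nilpotent q a b i : prime q -> nilpotent (b *+ q) ->
  nilpotent (a ^+ (q ^ i) - b ^+ (q ^ i)) -> nilpotent (a - b).
Proof.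
move=> qp; have q0 := prime_gt0 qp.
elim: i a b => [|i IH] a b nb; first by rewrite !expr1.
rewrite expnS !exprM => /IH Hab.
have {}Hab : nilpotent (a ^+ q - b ^+ q).
  by apply: Hab; rewrite -(prednK q0) exprS -mulrnAl prednK //; apply: nilpotentMr.
have := nilpotent_frobenius (a - b) qp nb; rewrite (addrC b) subrK => F.
apply: (@nilpotentX _ q).
have -> : (a - b) ^+ q =
  (a ^+ q - b ^+ q) - (a ^+ q - (b ^+ q + (a - b) ^+ q)) by ring.
exact: nilpotentB.
Qed.

Lemma nilpotent_periodic m x u l : nilpotent (x ^+ m.+1 - x) ->
  nilpotent (x ^+ (u.+1 + m * l) - x ^+ u.+1).
Proof.
move=> nx; elim: l => [|l IH]; first by rewrite muln0 addn0 subrr; apply: nilpotent0.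
apply: nilpotent_trans IH.
have -> : (u.+1 + m * l.+1 = (u + m * l) + m.+1)%N.
  by rewrite mulnSr addnA addSn addnS.
rewrite [in X in _ - X]addSn [in X in _ - X]exprSr exprD -mulrBr; exact: nilpotentMl.
Qed.

(** Modulo nilpotents, x ^ n for n > 0 depends only on n modulo m.  With s the
part of m prime to q and T = totient s, q ^ (i + T) is congruent to q ^ i
modulo m for i the valuation of m at q; injectivity of the Frobenius cancels
q ^ i. *)
Lemma power_eventually_fixed q m x : prime q -> (0 < m)%N ->
    nilpotent (x *+ q) -> nilpotent (x ^+ m.+1 - x) ->
  exists2 T, (0 < T)%N & nilpotent (x ^+ (q ^ T) - x).
Proof.
move=> qp m0 nq nx; pose s := (m`_q^')%N.
have s0 : (0 < s)%N by apply: part_gt0.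
have mE : (q ^ logn q m * s)%N = m by rewrite -p_part partnC.
exists (totient s); first by rewrite totient_gt0.
have /eqP : (q ^ totient s = 1 %[mod s])%N.
  by apply/Euler_exp_totient/(@pnat_coprime q); [apply: pnat_id|apply: part_pnat].
have qT : (0 < q ^ totient s)%N by rewrite expn_gt0 prime_gt0.
rewrite eqn_mod_dvd // => /dvdnP[l lE].
apply: (@frobenius_reflects_nilpotent q _ _ (logn q m)) => //.
have qi : (0 < q ^ logn q m)%N by rewrite expn_gt0 prime_gt0.
have e : (q ^ totient s * q ^ logn q m = q ^ logn q m + m * l)%N.
  rewrite -[X in (_ + X * l)%N]mE -(subnK qT) lE mulnDl.
  by rewrite mul1n addnC mulnC (mulnC l) mulnA.
rewrite -exprM e -(prednK qi); exact: nilpotent_periodic.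
Qed.

(** With Q as in [power_eventually_fixed], x ^ (Q ^ t) is congruent to x for all
t, and (x ^ m) ^ (Q ^ t) = x ^ (Q ^ t) for some t. *)
Lemma potent_power_lift q m x : prime q -> (1 < m)%N ->
    nilpotent (x *+ q) -> nilpotent (x ^+ m - x) ->
  exists2 M, potent m (x ^+ M.+1) & nilpotent (x - x ^+ M.+1).
Proof.
case: m => [//|m] qp m0 nq nx.
have [T T0 nT] := power_eventually_fixed qp m0 nq nx.
pose Q := (q ^ T)%N.
have Q1 : (1 < Q)%N by rewrite -(expn0 q) ltn_exp2l ?prime_gt1.
have nQ : nilpotent (x *+ Q).
  by rewrite /Q -(prednK T0) expnS mulrnA; apply: nilpotentMn.
have [t tE] := iter_power_eq Q1 nx nQ.
have Qt : (0 < Q ^ t)%N by rewrite expn_gt0 (ltnW Q1).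
exists (Q ^ t).-1; rewrite prednK //.
  by rewrite /potent -exprM mulnC exprM.
apply: nilpotent_sym; elim: t {tE Qt} => [|t IH].
  by rewrite expr1 subrr; apply: nilpotent0.
by apply: nilpotent_trans nT; rewrite expnSr exprM; apply: nilpotent_subX.
Qed.

End Nilpotent.

(** * Lifting potent elements inside a subring without unit *)

Section PotentLift.
Variables (R : comPzRingType) (S : set R).
Hypotheses (zS : zmod_closed [in S])
  (mulS : forall x y, S x -> S y -> S (x * y)).

Let natS x n : S x -> S (x *+ n).
Proof.
move=> Sx; elim: n => [|n IH]; first by rewrite mulr0n; apply: zmod_set0.
by rewrite mulrS; apply: zmod_setD.
Qed.

Let expS x n : S x -> S (x ^+ n.+1).
Proof.
by move=> Sx; elim: n => [|n IH]; rewrite ?expr1 // exprS; apply: mulS.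
Qed.

(** Potent elements equal their own powers of arbitrarily large exponent, so
p1 p2 vanishes once it is nilpotent; m-th powers then distribute over p1 + p2. *)
Lemma potent_add_disjoint m (p1 p2 : R) : (1 < m)%N -> potent m p1 ->
  potent m p2 -> nilpotent (p1 * p2) -> potent m (p1 + p2).
Proof.
move=> m1 e1 e2 [N N0].
have it (p : R) n : potent m p -> p ^+ (m ^ n) = p.
  by move=> ep; elim: n => [|n IH]; rewrite ?expr1 // expnSr exprM IH.
have p12 : p1 * p2 = 0.
  have Nm : (N <= m ^ N)%N by rewrite ltnW // ltn_expl.
  by rewrite -(it p1 N e1) -(it p2 N e2) -exprMn -(subnKC Nm) exprD N0 mul0r.
have [c] := exprD_disjoint p1 p2 m.-1.
by rewrite prednK ?(ltnW m1) // p12 mul0r addr0 e1 e2.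
Qed.

(** Modulo nilpotents, x1 x2 = 0 gives x1 ^ m + x2 ^ m = x1 + x2, and
multiplication by x1 leaves x1 (x1 ^ m - x1) = 0; as x1 divides x1 ^ m - x1,
the square of the latter is 0. *)
Lemma potent_summand m (x1 x2 : R) : (1 < m)%N -> nilpotent (x1 * x2) ->
  nilpotent ((x1 + x2) ^+ m - (x1 + x2)) -> nilpotent (x1 ^+ m - x1).
Proof.
case: m => [//|m] m0 n12; have [c ->] := exprD_disjoint x1 x2 m => nx.
apply: (@nilpotentX _ _ 2).
have -> : (x1 ^+ m.+1 - x1) ^+ 2 = (x1 ^+ m - 1) *
   (x1 * (x1 ^+ m.+1 + x2 ^+ m.+1 + x1 * x2 * c - (x1 + x2))
    - x1 * x2 * (x2 ^+ m + x1 * c - 1)) by rewrite !exprS; ring.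
by apply/nilpotentMl/nilpotentB; [apply: nilpotentMl|apply: nilpotentMr].
Qed.

(** Induction on k, splitting off the part of k at one prime q.  A common
exponent M for all primes dividing k need not exist, so x has to be cut into
pieces that are mutually orthogonal modulo nilpotents. *)
Lemma potent_lift m k x : (1 < m)%N -> (0 < k)%N -> S x ->
    nilpotent (x *+ k) -> nilpotent (x ^+ m - x) ->
  exists p, [/\ S p, potent m p & nilpotent (x - p)].
Proof.
move=> m1; elim/ltn_ind: k x => k IH x k0 Sx nk nx.
have [k1|k1] := leqP k 1.
  exists 0; split; first exact: zmod_set0.
    by rewrite /potent expr0n -(prednK (ltnW m1)).
  by rewrite subr0 -[x]mulr1n; have -> : 1%N = k by apply/eqP; rewrite eqn_leq k0 k1.
pose q := pdiv k; have qp : prime q by apply: pdiv_prime.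
pose kq := (k`_q)%N; pose k2 := (k`_q^')%N.
have kE : (kq * k2)%N = k by apply: partnC.
have kqE : kq = (q ^ logn q k)%N by apply: p_part.
have kq0 : (0 < kq)%N by apply: part_gt0.
have k20 : (0 < k2)%N by apply: part_gt0.
have k2k : (k2 < k)%N.
  rewrite -kE -[X in (X < _)%N]mul1n ltn_pmul2r // kqE -(expn0 q).
  by rewrite ltn_exp2l ?prime_gt1 // logn_gt0 mem_primes qp k0 pdiv_dvd.
have [u v uv _] := egcdnP k2 kq0.
have {}uv : (u * kq = v * k2 + 1)%N by rewrite uv (eqP (coprime_partC _ _ _)).
(* Modulo nilpotents, x1 is killed by the q-part of k and x2 by the rest. *)
pose x1 := - (x *+ (v * k2)); pose x2 := x *+ (u * kq).
have x12 : x1 + x2 = x by rewrite /x1 /x2 uv mulrnDr mulr1n addKr.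
have Sx1 : S x1 by apply/(zmod_setN zS)/natS.
have Sx2 : S x2 by apply: natS.
have n12 : nilpotent (x1 * x2).
  have -> : x1 * x2 = x *+ k * - (x *+ (u * v)).
    by rewrite /x1 /x2 -kE; ring.
  exact: nilpotentMr.
have n1 : nilpotent (x1 ^+ m - x1) by apply: (potent_summand m1 n12); rewrite x12.
have n2 : nilpotent (x2 ^+ m - x2).
  by apply: (@potent_summand m x2 x1); rewrite 1?mulrC // (addrC x2) x12.
have nk2 : nilpotent (x2 *+ k2).
  by rewrite -mulrnA -mulnA kE mulnC mulrnA; apply: nilpotentMn.
have nk1 : nilpotent (x1 *+ q).
  (* Only a power of q kills x1, but its factors can be spread over a power of
     q x1. *)
  set b := logn q k in kqE; apply: (@nilpotentX _ _ b.+1).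
  have -> : (x1 *+ q) ^+ b.+1 = x *+ k * (- (x1 ^+ b *+ (v * q))).
    rewrite -[X in x *+ X]kE kqE exprMn_n exprS expnS.
    by move: (x1 ^+ b) (q ^ b)%N => y c; rewrite /x1; ring.
  exact: nilpotentMr.
have [M pM nM] := potent_power_lift qp m1 nk1 n1.
have [p2 [Sp2 pp2 np2]] := IH k2 k2k x2 k20 Sx2 nk2 n2.
exists (x1 ^+ M.+1 + p2); split; first by apply: zmod_setD => //; apply: expS.
  apply: potent_add_disjoint => //.
  have -> : x1 ^+ M.+1 * p2 =
    x1 * x2 - ((x1 - x1 ^+ M.+1) * x2 + x1 ^+ M.+1 * (x2 - p2)) by ring.
  by apply/nilpotentB/nilpotentD => //; [apply: nilpotentMr|apply: nilpotentMl].
by rewrite -x12 opprD addrACA; apply: nilpotentD.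
Qed.

End PotentLift.

(** * Graded nil clean rings by nilpotency conditions *)

Section GradedNilClean.
Variables (m : nat) (G : groupType).
Hypotheses (m1 : (2 <= m)%N) (tfG : torsion_free (m - 1)%N G).

(** In x = p + n, directness makes the component of degree h vanish: it is p if
n has another degree, and p + n otherwise. *)
Lemma homogeneous_sum_cases (R : comPzRingType) (gr : grading G R) g h k x p n :
  gr g x -> gr h p -> gr k n -> x = p + n -> h != g -> p = 0 \/ p = - n.
Proof.
move=> xg ph nk xE hg.
pose c i := (if i == h then p else 0) + (if i == k then n else 0)
            - (if i == g then x else 0).
have zC := component_zmod gr.
have C (y : R) l i : gr l y -> gr i (if i == l then y else 0).
  by case: eqP => [->|_] // _; apply: zmod_set0.
have Cc i : gr i (c i).
  by apply: zmod_setB => //; [apply: zmod_setD => //|]; apply: C.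
pose s := [fset g; h; k]%fset.
have pick (y : R) l : l \in s -> \sum_(i <- s) (if i == l then y else 0) = y.
  move=> ls; rewrite (bigD1_seq l) ?fset_uniq //= eqxx big1 ?addr0 //.
  by move=> i /negPf->.
have : \sum_(i <- s) c i = 0.
  rewrite sumrB big_split /= !pick ?xE ?subrr // !inE eqxx ?orbT //.
move=> /(direct_sum_free (component_direct gr) zC Cc)/(_ h).
rewrite !inE eqxx orbT => /(_ isT); rewrite /c eqxx (negPf hg) subr0.
by case: ifP => _; [move/eqP; rewrite addr_eq0 => /eqP; right|rewrite addr0; left].
Qed.

Lemma potent_degree1 (R : comPzRingType) (gr : grading G R) g p :
  gr g p -> potent m p -> g != 1%g -> p = 0.
Proof.
move=> pg pm g1.
have mE : m = (m - 1).+1 by rewrite subn1 prednK // ltnW.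
have pX : gr (g ^+ m)%g p.
  rewrite -pm mE; elim: (m - 1)%N => [|l IH]; first by rewrite expr1 expg1.
  by rewrite exprS expgS; apply: component_mul.
have gmg : (g ^+ m)%g != g.
  apply: contra g1 => /eqP; rewrite {1}mE expgS => gE.
  by apply/eqP/tfG/(mulgI g); rewrite gE mulg1.
have [] // := @homogeneous_sum_cases _ gr g (g ^+ m)%g g p p 0 pg pX.
- exact: zmod_set0 (component_zmod gr g).
- by rewrite addr0.
- by rewrite oppr0.
Qed.

(** In x = p + n, either p has the degree of x, so that p = 0, or the degrees
force p = 0 or p = - n; in all cases p is nilpotent. *)
Lemma nil_clean_degree_neq1 (R : comPzRingType) (gr : grading G R) g x :
  graded_nil_clean m gr -> gr g x -> g != 1%g -> nilpotent x.
Proof.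
move=> clean xg g1; have [|p [n [[h _ ph] pm [k _ nk] nn xE]]] := clean x.
  by exists g.
rewrite xE; apply: nilpotentD => //.
have [hg|hg] := eqVneq h g.
  rewrite (potent_degree1 ph pm) ?hg //; exact: nilpotent0.
have [->|->] := homogeneous_sum_cases xg ph nk xE hg; first exact: nilpotent0.
exact: nilpotentN.
Qed.

Lemma nil_clean_nilpotent_sub (R : comPzRingType) (gr : grading G R) x :
  graded_nil_clean m gr -> homogeneous gr x -> nilpotent (x ^+ m - x).
Proof.
move=> clean /clean[p [n [_ pm _ nn ->]]].
have -> : (p + n) ^+ m - (p + n) = ((p + n) ^+ m - p ^+ m) - n.
  by rewrite pm opprD addrA.
apply: nilpotentB => //; apply: nilpotent_subX; by rewrite addrC addKr.
Qed.

(** Modulo nilpotents, 2 ^ m x = (2 x) ^ m = 2 x, because 2 x is again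
homogeneous. *)
Lemma nil_clean_torsion (R : comPzRingType) (gr : grading G R) x :
  graded_nil_clean m gr -> homogeneous gr x -> nilpotent (x *+ (2 ^ m - 2)).
Proof.
move=> clean xh; have nx := nil_clean_nilpotent_sub clean xh.
have n2x : nilpotent ((x *+ 2) ^+ m - x *+ 2).
  apply: (nil_clean_nilpotent_sub clean); case: xh => g _ xg; exists g => //.
  by rewrite mulr2n; apply: zmod_setD (component_zmod gr g) _ _.
have -> : x *+ (2 ^ m - 2) =
    ((x *+ 2) ^+ m - x *+ 2) - (x ^+ m - x) *+ (2 ^ m).
  rewrite mulrnBr; last by rewrite -{1}(expn1 2) leq_exp2l // ltnW.
  by rewrite exprMn_n; move: (2 ^ m)%N => c; ring.
by apply: nilpotentB => //; apply: nilpotentMn.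
Qed.

(** The criterion in terms of nilpotency: outside degree 1 the potent part is 0,
and in degree 1 it is given by [potent_lift]. *)
Lemma nil_clean_intro (R : comPzRingType) (gr : grading G R) k : (0 < k)%N ->
    (forall g x, gr g x -> g != 1%g -> nilpotent x) ->
    (forall x, gr 1%g x -> nilpotent (x *+ k) /\ nilpotent (x ^+ m - x)) ->
  graded_nil_clean m gr.
Proof.
move=> k0 nil1 near x [g _ xg]; have zC := component_zmod gr.
have [g1|g1] := eqVneq g 1%g; last first.
  exists 0, x; split; rewrite ?add0r //.
  - by exists g => //; apply: zmod_set0.
  - by rewrite /potent expr0n -(prednK (ltnW m1)).
  - by exists g.
  - exact: nil1 xg g1.
rewrite {}g1 in xg; have [nk nx] := near x xg.
have mul1 y z : gr 1%g y -> gr 1%g z -> gr 1%g (y * z).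
  by move=> y1 z1; rewrite -[1%g]mulg1; apply: component_mul.
have [p [p1 pm np]] := potent_lift (zC 1%g) mul1 m1 k0 xg nk nx.
exists p, (x - p); split=> //.
- by exists 1%g.
- by exists 1%g => //; apply: zmod_setB.
- by rewrite addrC subrK.
Qed.

Lemma nil_clean_image (R R' : comPzRingType) (gr : grading G R)
    (gr' : grading G R') (phi : {rmorphism R -> R'}) :
    (forall g, phi @` gr g = gr' g) ->
  graded_nil_clean m gr -> graded_nil_clean m gr'.
Proof.
move=> img clean y [g _]; rewrite -img => -[x xg <-].
have homog z : homogeneous gr z -> homogeneous gr' (phi z).
  by case=> h _ zh; exists h => //; rewrite -img; exists z.
have [|p [n [ph pm nh [N nN] ->]]] := clean x; first by exists g.
exists (phi p), (phi n); split; rewrite ?rmorphD //; try exact: homog.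
  by rewrite /potent -rmorphXn pm.
by exists N; rewrite -rmorphXn nN rmorph0.
Qed.

(** An element of R is nilpotent when both its images are, so the hypotheses of
[nil_clean_intro] descend from the factors to R. *)
Lemma nil_clean_subproduct (R R1 R2 : comPzRingType) (gr : grading G R)
    (gr1 : grading G R1) (gr2 : grading G R2)
    (phi1 : {rmorphism R -> R1}) (phi2 : {rmorphism R -> R2}) :
    graded_morphism gr gr1 phi1 -> graded_morphism gr gr2 phi2 ->
    (forall x, phi1 x = 0 -> phi2 x = 0 -> x = 0) ->
  graded_nil_clean m gr1 -> graded_nil_clean m gr2 -> graded_nil_clean m gr.
Proof.
move=> h1 h2 inj clean1 clean2.
have im1 g x : gr g x -> gr1 g (phi1 x) by move=> xg; apply: h1; exists x.
have im2 g x : gr g x -> gr2 g (phi2 x) by move=> xg; apply: h2; exists x.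
have hom1 g x : gr g x -> homogeneous gr1 (phi1 x).
  by move=> /im1 xg; exists g.
have hom2 g x : gr g x -> homogeneous gr2 (phi2 x).
  by move=> /im2 xg; exists g.
have nil x : nilpotent (phi1 x) -> nilpotent (phi2 x) -> nilpotent x.
  move=> [n1 e1] [n2 e2]; exists (n1 + n2)%N.
  by apply: inj; rewrite rmorphXn exprD ?e1 ?e2 ?mul0r ?mulr0.
apply: (@nil_clean_intro _ _ (2 ^ m - 2)).
- by rewrite subn_gt0 -{1}(expn1 2) ltn_exp2l.
- move=> g x xg g1; apply: nil.
    exact: nil_clean_degree_neq1 clean1 (im1 _ _ xg) g1.
  exact: nil_clean_degree_neq1 clean2 (im2 _ _ xg) g1.
- move=> x xg; split; apply: nil; rewrite ?rmorphB ?rmorphXn ?rmorphMn /=.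
  + exact: nil_clean_torsion clean1 (hom1 _ _ xg).
  + exact: nil_clean_torsion clean2 (hom2 _ _ xg).
  + exact: nil_clean_nilpotent_sub clean1 (hom1 _ _ xg).
  + exact: nil_clean_nilpotent_sub clean2 (hom2 _ _ xg).
Qed.

End GradedNilClean.

(** * The two projections of the amalgamation *)

Section Projections.
Variables (A B : comPzRingType) (f : {rmorphism A -> B}) (J : ideal B).

Definition amalg_fst (x : amalg f J) : A := (amalg_val x).1.

Lemma amalg_snd_subproof (x : amalg f J) :
  (amalg_val x).2 \in sumring_pred f J.
Proof.
have /set_mem[a _ [j Jj <-]] := valP x.
by apply/mem_set; exists a => //; exists j.
Qed.

Definition amalg_snd (x : amalg f J) : sumring f J :=
  Sumring (amalg_snd_subproof x).

Fact amalg_fst_zmod : zmod_morphism amalg_fst.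
Proof. by move=> x y; rewrite /amalg_fst amalg_valB. Qed.

Fact amalg_fst_monoid : monoid_morphism amalg_fst.
Proof. by split=> // x y; rewrite /amalg_fst amalg_valM. Qed.

HB.instance Definition _ :=
  GRing.isZmodMorphism.Build (amalg f J) A amalg_fst amalg_fst_zmod.
HB.instance Definition _ :=
  GRing.isMonoidMorphism.Build (amalg f J) A amalg_fst amalg_fst_monoid.

Fact amalg_snd_zmod : zmod_morphism amalg_snd.
Proof. by move=> x y; apply: val_inj; exact: (congr1 snd (amalg_valB x y)). Qed.

Fact amalg_snd_monoid : monoid_morphism amalg_snd.
Proof.
by split=> [|x y]; apply: val_inj => //; exact: (congr1 snd (amalg_valM x y)).
Qed.

HB.instance Definition _ :=
  GRing.isZmodMorphism.Build (amalg f J) (sumring f J) amalg_snd amalg_snd_zmod.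
HB.instance Definition _ :=
  GRing.isMonoidMorphism.Build (amalg f J) (sumring f J) amalg_snd
    amalg_snd_monoid.

Lemma amalg_proj_eq0 x : amalg_fst x = 0 -> amalg_snd x = 0 -> x = 0.
Proof.
move=> x1 /(congr1 val) /= x2; apply: val_inj => /=.
by rewrite [LHS]surjective_pairing x2 [(_).1]x1.
Qed.

Variables (G : groupType) (grA : grading G A) (grB : grading G B).
Hypotheses (hf : graded_morphism grA grB f) (hJ : homogeneous_ideal grB J).

Lemma amalg_of_graded g a j : grA g a -> (J `&` grB g) j ->
  exists2 x : amalg f J, amalg_grading hf hJ g x & amalg_val x = (a, f a + j).
Proof.
move=> ag jg.
have mem : (a, f a + j) \in amalg_pred f J.
  by apply/mem_set; exists a => //; exists j => //; case: jg.
by exists (Amalg mem) => //; exists a => //; exists j.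
Qed.

Lemma amalg_fst_image g : amalg_fst @` amalg_grading hf hJ g = grA g.
Proof.
apply/seteqP; split=> [_ [x [a ag [j _ xE]] <-]|a ag].
  by rewrite /amalg_fst -xE.
have j0 : (J `&` grB g) 0.
  by split; [apply: zmod_set0 (ideal_zmod J)|apply: zmod_set0 (component_zmod grB g)].
by have [x xg xE] := amalg_of_graded ag j0; exists x; rewrite /amalg_fst ?xE.
Qed.

Lemma amalg_snd_image g :
  amalg_snd @` amalg_grading hf hJ g = sumring_grading hf hJ g.
Proof.
apply/seteqP; split=> [_ [x [a ag [j jg xE]] <-]|y [a ag [j jg yE]]].
  by exists a => //; exists j => //; rewrite /= -xE.
have [x xg xE] := amalg_of_graded ag jg; exists x => //.
by apply: val_inj; rewrite /= xE.
Qed.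

End Projections.

Theorem theorem4p1 (m : nat) (hm : (2 <= m)%N) (G : groupType)
    (hG : torsion_free (m - 1)%N G) (A B : comPzRingType)
    (grA : grading G A) (grB : grading G B) (f : {rmorphism A -> B})
    (hf : graded_morphism grA grB f) (J : ideal B)
    (hJ : homogeneous_ideal grB J) :
  graded_nil_clean m (amalg_grading hf hJ) <->
  graded_nil_clean m grA /\ graded_nil_clean m (sumring_grading hf hJ).
Proof.
split=> [clean|[cleanA cleanS]].
  split.
    exact: (@nil_clean_image m G _ _ _ _ (@amalg_fst A B f J)
              (@amalg_fst_image _ _ _ _ _ _ _ hf hJ)).
  exact: (@nil_clean_image m G _ _ _ _ (@amalg_snd A B f J)
            (@amalg_snd_image _ _ _ _ _ _ _ hf hJ)).
apply: (@nil_clean_subproduct m G hm hG _ _ _ _ _ _ (@amalg_fst A B f J)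
  (@amalg_snd A B f J) _ _ (@amalg_proj_eq0 _ _ f J) cleanA cleanS) => g.
  by rewrite amalg_fst_image.
by rewrite amalg_snd_image.
Qed.
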